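(* Let $n=1$ and let $e^1,\dots,e^m$ be $C^\infty$ functions of $(x,w^{j'},w^{j'}_1,w^{j'}_2)$ (second-order data), defined on the whole corresponding Euclidean space. If there exists a Lagrange function $f$ of some finite order with $e^j=e^j[f]$ for all $j=1,\dots,m$, then each $e^j$ is affine in the second-order variables, $e^j=F^j-\sum_{j'}F^{jj'}w^{j'}_2$ with $F^j,F^{jj'}$ functions of $(x,w,w_1)$ and $F^{jj'}=F^{j'j}$, and there exists a first-order Lagrange function $g(x,w,w_1)$ with $e^j[g]=e^j$ for all $j$.
   Context: One independent variable $x$, dependent variables $w^1,\dots,w^m$; jet coordinates $w^j_r$ ($r\ge0$, $w^j_0=w^j$) standing for $d^rw^j/dx^r$. A Lagrange function is a $C^\infty$ function of $x$ and finitely many $w^j_r$, defined on the whole corresponding Euclidean space. $\frac{d}{dx}=\partial_x+\sum_{j,r}w^j_{r+1}\partial_{w^j_r}$ and $e^j[f]=\sum_r(-1)^r\frac{d^r}{dx^r}\frac{\partial f}{\partial w^j_r}$. *)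

(* Defs.v *)
From Stdlib Require Import Reals Lra Lia Arith ClassicalEpsilon.
Open Scope R_scope.

(* Jet coordinates: w j r stands for w^j_r = d^r w^j / dx^r
   (dependent-variable index j = 0..m-1 corresponds to the paper's 1..m). *)
Definition Jet := nat -> nat -> R.

Definition JFun := R -> Jet -> R.

Fixpoint rsum (n : nat) (f : nat -> R) : R :=
  match n with O => 0 | S n' => rsum n' f + f n' end.

Definition upd (w : Jet) (j r : nat) (t : R) : Jet :=
  fun j' r' => if andb (Nat.eqb j' j) (Nat.eqb r' r) then t else w j' r'.

(* the derivative of g at a (when it exists; a default value otherwise) *)
Definition lim_deriv (g : R -> R) (a : R) : R :=
  epsilon (inhabits 0) (fun l => derivable_pt_lim g a l).

Definition pdx (F : JFun) : JFun := fun x w => lim_deriv (fun t => F t w) x.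
Definition pdw (j r : nat) (F : JFun) : JFun :=
  fun x w => lim_deriv (fun t => F x (upd w j r t)) (w j r).

Definition depends_on (m k : nat) (F : JFun) : Prop :=
  forall x w w', (forall j r, (j < m)%nat -> (r <= k)%nat -> w j r = w' j r) ->
    F x w = F x w'.

Definition jcont (m k : nat) (F : JFun) : Prop :=
  forall x w eps, 0 < eps -> exists delta, 0 < delta /\
    forall x' w', Rabs (x' - x) < delta ->
      (forall j r, (j < m)%nat -> (r <= k)%nat -> Rabs (w' j r - w j r) < delta) ->
      Rabs (F x' w' - F x w) < eps.

Fixpoint Cn (m k n : nat) (F : JFun) : Prop :=
  jcont m k F /\
  match n with
  | O => True
  | S n' =>
      (forall x w, exists l, derivable_pt_lim (fun t => F t w) x l) /\
      Cn m k n' (pdx F) /\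
      (forall j r, (j < m)%nat -> (r <= k)%nat ->
         (forall x w, exists l, derivable_pt_lim (fun t => F x (upd w j r t)) (w j r) l) /\
         Cn m k n' (pdw j r F))
  end.

Definition Smooth (m k : nat) (F : JFun) : Prop :=
  depends_on m k F /\ forall n, Cn m k n F.

(* total derivative d/dx = d_x + sum_{j,r} w^j_{r+1} d_{w^j_r}, truncated to r < N
   (exact for functions of order < N, since the remaining partials vanish) *)
Definition tot (N m : nat) (F : JFun) : JFun :=
  fun x w => pdx F x w + rsum m (fun j => rsum N (fun r => w j (S r) * pdw j r F x w)).

(* Euler operator e^j[f] = sum_r (-1)^r (d/dx)^r (d f / d w^j_r), for f of order <= k.
   (d/dx)^r applied to a function of order <= k+r <= 2k; truncation N = 2k+1 is exact. *)
Definition euler (m k : nat) (f : JFun) (j : nat) : JFun :=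
  fun x w => rsum (S k) (fun r => (-1) ^ r * Nat.iter r (tot (2 * k + 1) m) (pdw j r f) x w).

(* Main.v *)
Require Import Defs.
From Stdlib Require Import Reals Lra Lia Arith Classical ClassicalEpsilon FunctionalExtensionality.
From Coquelicot Require Import Coquelicot.
Open Scope R_scope.

(* The order of the Lagrangian is lowered directly, without the Helmholtz conditions.
   If f has order k >= 2 and E[f] has order 2, then the coefficients of w_{2k} and
   w_{2k-1} in E[f] vanish. The first says that the b_j = df/dw^j_k do not involve w_k;
   the second says that sum_j b_j dw^j_{k-1} is closed. Since E[Dh] = 0, one may subtract
   from f the total derivative of a primitive of this form, which leaves a Lagrangian of
   order k - 1 with the same Euler expressions. The primitive is built one variable at a
   time, so that only integrals over a single coordinate occur. At order 1 the affine form
   of E[g] is read off, F^{ij} being the Hessian of g in w_1. *)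

(** * Partial derivatives and smoothness *)

(** The threshold in the descent comes from comparing indices: 2k and 2k-1 both exceed 2 exactly
    when k >= 2, so the second-order hypothesis kills both coefficients down to k = 2 and says
    nothing of the kind at k = 1. Integrating from 0 along a coordinate line is always possible
    because all functions live on the whole Euclidean space, so no topological obstruction arises.
    The analytic burden lies elsewhere: the subtracted primitive must again be smooth in every
    variable, which needs parameter integrals that are continuous and can be differentiated under
    the integral sign, to all orders. Instead of tracking orders of differentiability, smoothness is
    treated as the largest class of continuous functions of bounded order that is stable under
    partial derivatives; exhibiting one stable family that contains the integrals is then enough. *)

Lemma jfun_ext (F G : JFun) : (forall x w, F x w = G x w) -> F = G.
Proof.
  intros H; apply functional_extensionality; intros x.
  apply functional_extensionality; intros w; apply H.
Qed.

Lemma upd_same (w : Jet) (j r : nat) (t : R) : upd w j r t j r = t.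
Proof. unfold upd; now rewrite !Nat.eqb_refl. Qed.

Lemma upd_other (w : Jet) (j r : nat) (t : R) (j' r' : nat) :
  (j', r') <> (j, r) -> upd w j r t j' r' = w j' r'.
Proof.
  intros H; unfold upd.
  destruct (Nat.eqb_spec j' j); destruct (Nat.eqb_spec r' r); simpl; congruence.
Qed.

Lemma upd_cases (w : Jet) (j r : nat) (t : R) (j' r' : nat) :
  ((j', r') = (j, r) /\ upd w j r t j' r' = t) \/
  ((j', r') <> (j, r) /\ upd w j r t j' r' = w j' r').
Proof.
  destruct (Nat.eq_dec j' j) as [->|]; [destruct (Nat.eq_dec r' r) as [->|]|].
  - left; split; [reflexivity | apply upd_same].
  - right; split; [congruence | apply upd_other; congruence].
  - right; split; [congruence | apply upd_other; congruence].
Qed.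

Lemma jet_ext (w w' : Jet) : (forall j r, w j r = w' j r) -> w = w'.
Proof.
  intros H; apply functional_extensionality; intros j.
  apply functional_extensionality; intros r; apply H.
Qed.

Lemma upd_id (w : Jet) (j r : nat) : upd w j r (w j r) = w.
Proof.
  apply jet_ext; intros j' r'.
  destruct (upd_cases w j r (w j r) j' r') as [[E ->]|[_ ->]]; congruence.
Qed.

Lemma upd_upd (w : Jet) (j r : nat) (s t : R) : upd (upd w j r s) j r t = upd w j r t.
Proof.
  apply jet_ext; intros j' r'.
  destruct (upd_cases w j r t j' r') as [[[= -> ->] ->]|[E ->]].
  - apply upd_same.
  - now rewrite !upd_other.
Qed.

Lemma upd_comm (w : Jet) (j r j' r' : nat) (s t : R) :
  (j, r) <> (j', r') -> upd (upd w j r s) j' r' t = upd (upd w j' r' t) j r s.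
Proof.
  intros H; apply jet_ext; intros a b.
  destruct (upd_cases (upd w j r s) j' r' t a b) as [[[= -> ->] ->]|[E ->]].
  - rewrite upd_other by congruence. now rewrite upd_same.
  - destruct (upd_cases w j r s a b) as [[[= -> ->] ->]|[E' ->]].
    + now rewrite upd_same.
    + now rewrite !upd_other.
Qed.

(* [None] is the independent variable x and [Some (j, r)] is w^j_r, so that [pd]
   unifies [pdx] and [pdw]. *)
Definition coord := option (nat * nat).

Definition setx (c : coord) (t x : R) : R :=
  match c with None => t | Some _ => x end.
Definition setw (c : coord) (t : R) (w : Jet) : Jet :=
  match c with None => w | Some (j, r) => upd w j r t end.
Definition cur (c : coord) (x : R) (w : Jet) : R :=
  match c with None => x | Some (j, r) => w j r end.
Definition slice (c : coord) (F : JFun) (x : R) (w : Jet) (t : R) : R :=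
  F (setx c t x) (setw c t w).
Definition pd (c : coord) (F : JFun) : JFun :=
  fun x w => lim_deriv (slice c F x w) (cur c x w).

Lemma setx_setx (c : coord) (s t x : R) : setx c t (setx c s x) = setx c t x.
Proof. now destruct c. Qed.

Lemma setw_setw (c : coord) (s t : R) (w : Jet) : setw c t (setw c s w) = setw c t w.
Proof. destruct c as [[j r]|]; simpl; [apply upd_upd | reflexivity]. Qed.

Lemma setx_cur (c : coord) (x : R) (w : Jet) : setx c (cur c x w) x = x.
Proof. now destruct c as [[j r]|]. Qed.

Lemma setw_cur (c : coord) (x : R) (w : Jet) : setw c (cur c x w) w = w.
Proof. destruct c as [[j r]|]; simpl; [apply upd_id | reflexivity]. Qed.

Lemma slice_cur (c : coord) (F : JFun) (x : R) (w : Jet) : slice c F x w (cur c x w) = F x w.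
Proof. unfold slice; now rewrite setx_cur, setw_cur. Qed.

Lemma slice_set (c : coord) (F : JFun) (x : R) (w : Jet) (s : R) :
  slice c F (setx c s x) (setw c s w) = slice c F x w.
Proof.
  apply functional_extensionality; intros t; unfold slice.
  now rewrite setx_setx, setw_setw.
Qed.

Lemma cur_set (c : coord) (x : R) (w : Jet) (s : R) : cur c (setx c s x) (setw c s w) = s.
Proof. destruct c as [[j r]|]; simpl; now rewrite ?upd_same. Qed.

Lemma setx_comm (c d : coord) (s t x : R) :
  c <> d -> setx c s (setx d t x) = setx d t (setx c s x).
Proof. destruct c, d; simpl; congruence. Qed.

Lemma setw_comm (c d : coord) (s t : R) (w : Jet) :
  c <> d -> setw c s (setw d t w) = setw d t (setw c s w).
Proof.
  destruct c as [[j r]|], d as [[j' r']|]; simpl; try congruence.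
  intros H; apply upd_comm; congruence.
Qed.

Lemma cur_setd (c d : coord) (t x : R) (w : Jet) :
  c <> d -> cur c (setx d t x) (setw d t w) = cur c x w.
Proof.
  destruct c as [[j r]|], d as [[j' r']|]; simpl; try congruence.
  intros H; apply upd_other; congruence.
Qed.

Lemma lim_deriv_eq (g : R -> R) (a l : R) : derivable_pt_lim g a l -> lim_deriv g a = l.
Proof.
  intros H; unfold lim_deriv; apply uniqueness_limite with g a; [|exact H].
  apply epsilon_spec; now exists l.
Qed.

(** Kept as a relation because [lim_deriv] returns an arbitrary value where no derivative exists:
    the equation [pd c F = G] alone would not give differentiability. *)
Definition has_pd (c : coord) (F G : JFun) : Prop :=
  forall x w, derivable_pt_lim (slice c F x w) (cur c x w) (G x w).

Lemma has_pd_eq (c : coord) (F G : JFun) : has_pd c F G -> pd c F = G.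
Proof. intros H; apply jfun_ext; intros x w; apply lim_deriv_eq, H. Qed.

(** [has_pd] speaks only of the current value of the coordinate. Moving the base point along [c]
    does not change the slice, so the derivative is known at every [t]. *)
Lemma has_pd_slice (c : coord) (F G : JFun) (x : R) (w : Jet) (t : R) :
  has_pd c F G -> derivable_pt_lim (slice c F x w) t (slice c G x w t).
Proof.
  intros H; specialize (H (setx c t x) (setw c t w)).
  now rewrite slice_set, cur_set in H.
Qed.

Lemma has_pd_slice_other (c d : coord) (F G : JFun) (x : R) (w : Jet) (s : R) :
  c <> d -> has_pd c F G ->
  derivable_pt_lim (fun t => slice d F (setx c t x) (setw c t w) s) (cur c x w)
    (slice d G x w s).
Proof.
  intros Hcd H; specialize (H (setx d s x) (setw d s w)).
  rewrite cur_setd in H by exact Hcd.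
  replace (fun t => slice d F (setx c t x) (setw c t w) s)
    with (slice c F (setx d s x) (setw d s w)); [exact H|].
  apply functional_extensionality; intros t; unfold slice.
  now rewrite setx_comm, setw_comm.
Qed.

Lemma has_pd_const (c : coord) (a : R) : has_pd c (fun _ _ => a) (fun _ _ => 0).
Proof. intros x w; apply derivable_pt_lim_const. Qed.

Lemma has_pd_add (c : coord) (F G F' G' : JFun) :
  has_pd c F F' -> has_pd c G G' ->
  has_pd c (fun x w => F x w + G x w) (fun x w => F' x w + G' x w).
Proof.
  intros HF HG x w.
  exact (derivable_pt_lim_plus _ _ _ _ _ (HF x w) (HG x w)).
Qed.

Lemma has_pd_mul (c : coord) (F G F' G' : JFun) :
  has_pd c F F' -> has_pd c G G' ->
  has_pd c (fun x w => F x w * G x w) (fun x w => F' x w * G x w + F x w * G' x w).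
Proof.
  intros HF HG x w.
  pose proof (derivable_pt_lim_mult _ _ _ _ _ (HF x w) (HG x w)) as H.
  rewrite !slice_cur in H. exact H.
Qed.

Definition delta (c : coord) (j r : nat) : R :=
  match c with
  | None => 0
  | Some (j', r') => if (Nat.eqb j j' && Nat.eqb r r')%bool then 1 else 0
  end.

Lemma has_pd_coord (c : coord) (j r : nat) :
  has_pd c (fun _ w => w j r) (fun _ _ => delta c j r).
Proof.
  intros x w; destruct c as [[j' r']|]; unfold slice; simpl.
  - unfold upd; destruct (Nat.eqb j j' && Nat.eqb r r')%bool.
    + apply derivable_pt_lim_id.
    + apply derivable_pt_lim_const.
  - apply derivable_pt_lim_const.
Qed.

Lemma has_pd_independent (c : coord) (F : JFun) :
  (forall x w t, slice c F x w t = F x w) -> has_pd c F (fun _ _ => 0).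
Proof.
  intros H x w.
  replace (slice c F x w) with (fun _ : R => F x w)
    by (apply functional_extensionality; intros t; now rewrite H).
  apply derivable_pt_lim_const.
Qed.

Lemma slice_out (m k j r : nat) (F : JFun) (x : R) (w : Jet) (t : R) :
  depends_on m k F -> (m <= j)%nat \/ (k < r)%nat -> slice (Some (j, r)) F x w t = F x w.
Proof.
  intros H Hjr; apply H; intros j' r' Hj Hr; apply upd_other.
  intros [= -> ->]; lia.
Qed.

Lemma depends_on_slice (m k : nat) (c : coord) (F : JFun) (x : R) (w w' : Jet) (t : R) :
  depends_on m k F ->
  (forall j r, (j < m)%nat -> (r <= k)%nat -> w j r = w' j r) ->
  slice c F x w t = slice c F x w' t.
Proof.
  intros H Hw; apply H; intros j r Hj Hr.
  destruct c as [[j' r']|]; simpl; [|now apply Hw].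
  unfold upd; destruct (Nat.eqb j j' && Nat.eqb r r')%bool; [reflexivity | now apply Hw].
Qed.

Lemma has_pd_out (m k j r : nat) (F : JFun) :
  depends_on m k F -> (m <= j)%nat \/ (k < r)%nat -> has_pd (Some (j, r)) F (fun _ _ => 0).
Proof. intros; apply has_pd_independent; intros; eapply slice_out; eauto. Qed.

Lemma depends_on_has_pd (m k : nat) (c : coord) (F G : JFun) :
  depends_on m k F -> has_pd c F G -> depends_on m k G.
Proof.
  intros HF HG x w w' Hw.
  assert (E : slice c F x w = slice c F x w')
    by (apply functional_extensionality; intros t; now apply (depends_on_slice m k)).
  (* The slices agree, but the points at which they are differentiated may not. If they differ, the
     coordinate lies outside the range of [m] and [k], and the derivative is 0 everywhere. *)
  destruct (classic (cur c x w = cur c x w')) as [Ec|Ec].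
  - apply uniqueness_limite with (slice c F x w) (cur c x w); [apply HG|].
    rewrite E, Ec; apply HG.
  - destruct c as [[j r]|]; [|now contradiction Ec].
    rewrite <- (has_pd_eq _ _ _ HG).
    rewrite (has_pd_eq _ _ _ (has_pd_out m k j r F HF ltac:(
      destruct (le_lt_dec m j), (le_lt_dec r k); try lia;
      contradiction Ec; now apply Hw))).
    reflexivity.
Qed.

Lemma smooth_jcont (m k : nat) (F : JFun) : Smooth m k F -> jcont m k F.
Proof. intros [_ H]; apply (H 0%nat). Qed.

(** [Cn] grants derivatives only along coordinates in range; along all others the slice is constant.
    Hence no range condition on [c] is needed from here on. *)
Lemma smooth_has_pd (m k : nat) (c : coord) (F : JFun) : Smooth m k F -> has_pd c F (pd c F).
Proof.
  intros [HF H] x w.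
  assert (D : exists l, derivable_pt_lim (slice c F x w) (cur c x w) l).
  { destruct (H 1%nat) as [_ [Hx [_ Hw]]].
    destruct c as [[j r]|]; [|exact (Hx x w)].
    destruct (le_lt_dec m j) as [Hj|Hj]; [|destruct (le_lt_dec r k) as [Hr|Hr]].
    - exists 0; apply has_pd_independent; intros; eapply slice_out; eauto.
    - exact (proj1 (Hw j r Hj Hr) x w).
    - exists 0; apply has_pd_independent; intros; eapply slice_out; eauto. }
  destruct D as [l D]; unfold pd; now rewrite (lim_deriv_eq _ _ _ D).
Qed.

(** A coinduction principle: any class of continuous functions of order [k] that is stable under
    partial derivatives consists of smooth functions, by induction on the level of [Cn]. *)
Lemma smooth_coind (m k : nat) (P : JFun -> Prop) :
  (forall F, P F -> depends_on m k F /\ jcont m k F /\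
     forall c, exists G, has_pd c F G /\ P G) ->
  forall F, P F -> Smooth m k F.
Proof.
  intros H F HF; split; [now apply H|].
  intros n; revert F HF; induction n as [|n IH]; intros F HF;
    destruct (H F HF) as [_ [Hc Hd]]; simpl; [now split|].
  assert (Hp : forall c, (forall x w, exists l, derivable_pt_lim (slice c F x w) (cur c x w) l)
                /\ Cn m k n (pd c F)).
  { intros c; destruct (Hd c) as [G [HG PG]]; split.
    - intros x w; exists (G x w); apply HG.
    - rewrite (has_pd_eq _ _ _ HG); now apply IH. }
  split; [exact Hc|].
  split; [apply (Hp None)|]. split; [apply (Hp None)|].
  intros j r _ _; apply (Hp (Some (j, r))).
Qed.

Lemma jcont_const (m k : nat) (a : R) : jcont m k (fun _ _ => a).
Proof.
  intros x w eps He; exists 1; split; [lra|]; intros.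
  now rewrite Rminus_diag, Rabs_R0.
Qed.

Lemma smooth_zero (m k : nat) : Smooth m k (fun _ _ => 0).
Proof.
  apply smooth_coind with (P := fun F => F = fun _ _ => 0); [|reflexivity].
  intros F ->; split; [|split].
  - now intros x w w' _.
  - apply jcont_const.
  - intros c; exists (fun _ _ => 0); split; [apply has_pd_const | reflexivity].
Qed.

Lemma smooth_pd (m k : nat) (c : coord) (F : JFun) : Smooth m k F -> Smooth m k (pd c F).
Proof.
  intros HF; pose proof (smooth_has_pd m k c F HF) as Hp; destruct HF as [HF H].
  destruct c as [[j r]|].
  - destruct (le_lt_dec m j) as [Hj|Hj]; [|destruct (le_lt_dec r k) as [Hr|Hr]].
    + rewrite (has_pd_eq _ _ _ (has_pd_out m k j r F HF (or_introl Hj))); apply smooth_zero.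
    + split; [eapply depends_on_has_pd; eauto|].
      intros n; destruct (H (S n)) as [_ [_ [_ Hw]]]; now apply Hw.
    + rewrite (has_pd_eq _ _ _ (has_pd_out m k j r F HF (or_intror Hr))); apply smooth_zero.
  - split; [eapply depends_on_has_pd; eauto|].
    intros n; destruct (H (S n)) as [_ [_ [Hx _]]]; apply Hx.
Qed.

Lemma jcont_order (m k k' : nat) (F : JFun) :
  jcont m k' F -> depends_on m k F -> jcont m k F.
Proof.
  intros Hc HF x w eps He.
  destruct (Hc x w eps He) as [d [Hd H]]; exists d; split; [exact Hd|].
  intros x' w' Hx Hw.
  (* [w''] follows [w'] on the coordinates that [F] can see and stays at [w] elsewhere, so it is
     close to [w] in all coordinates up to order [k'] while [F] takes the same value. *)
  set (w'' := fun j r => if (Nat.ltb j m && Nat.leb r k)%bool then w' j r else w j r).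
  rewrite (HF x' w' w'').
  - apply H; [exact Hx|]; intros j r Hj Hr; unfold w''.
    destruct (Nat.ltb_spec j m), (Nat.leb_spec r k); simpl;
      try (now rewrite Rminus_diag, Rabs_R0); now apply Hw.
  - intros j r Hj Hr; unfold w''.
    destruct (Nat.ltb_spec j m), (Nat.leb_spec r k); simpl; (reflexivity || lia).
Qed.

(** No relation between [k] and [k'] is imposed, so this serves both to raise the order and to lower
    it once the top variables are known to be absent. *)
Lemma smooth_order (m k k' : nat) (F : JFun) :
  Smooth m k' F -> depends_on m k F -> Smooth m k F.
Proof.
  intros HF HD.
  apply smooth_coind with (P := fun F => Smooth m k' F /\ depends_on m k F); [|now split].
  clear F HF HD; intros F [HF HD]; split; [exact HD|split].
  - eapply jcont_order; [eapply smooth_jcont; eauto|exact HD].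
  - intros c; pose proof (smooth_has_pd m k' c F HF) as Hp.
    exists (pd c F); split; [exact Hp|split].
    + now apply smooth_pd.
    + eapply depends_on_has_pd; eauto.
Qed.

Lemma depends_on_le (m k k' : nat) (F : JFun) :
  (k <= k')%nat -> depends_on m k F -> depends_on m k' F.
Proof. intros Hk H x w w' Hw; apply H; intros; apply Hw; lia. Qed.

Lemma smooth_le (m k k' : nat) (F : JFun) : (k <= k')%nat -> Smooth m k F -> Smooth m k' F.
Proof.
  intros Hk HF; apply smooth_order with k; [exact HF|].
  apply depends_on_le with k; [exact Hk | apply HF].
Qed.

(** * Closure properties of smooth functions *)

Definition near (m k : nat) (d x : R) (w : Jet) (x' : R) (w' : Jet) : Prop :=
  Rabs (x' - x) < d /\
  forall j r, (j < m)%nat -> (r <= k)%nat -> Rabs (w' j r - w j r) < d.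

Lemma near_le (m k : nat) (d d' x : R) (w : Jet) (x' : R) (w' : Jet) :
  d <= d' -> near m k d x w x' w' -> near m k d' x w x' w'.
Proof.
  intros Hd [Hx Hw]; split; [lra|]; intros j r Hj Hr; specialize (Hw j r Hj Hr); lra.
Qed.

Lemma near_upd (m k i p : nat) (d x : R) (w : Jet) (x' : R) (w' : Jet) (s t : R) :
  near m k d x w x' w' -> Rabs (t - s) < d ->
  near m k d x (upd w i p s) x' (upd w' i p t).
Proof.
  intros [Hx Hw] Hst; split; [exact Hx|]; intros j r Hj Hr.
  destruct (upd_cases w i p s j r) as [[[= -> ->] ->]|[E ->]].
  - now rewrite upd_same.
  - rewrite upd_other by exact E; now apply Hw.
Qed.

Lemma near_refl (m k : nat) (d x : R) (w : Jet) : 0 < d -> near m k d x w x w.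
Proof. intros Hd; split; intros; now rewrite Rminus_diag, Rabs_R0. Qed.

Lemma jcont_near (m k : nat) (F : JFun) :
  jcont m k F <-> forall x w eps, 0 < eps -> exists d, 0 < d /\
    forall x' w', near m k d x w x' w' -> Rabs (F x' w' - F x w) < eps.
Proof.
  split; intros H x w eps He; destruct (H x w eps He) as [d [Hd Hn]];
    exists d; (split; [exact Hd|]).
  - intros x' w' [Hx Hw]; now apply Hn.
  - intros x' w' Hx Hw; apply Hn; now split.
Qed.

Lemma jcont_coord (m k j r : nat) :
  (j < m)%nat -> (r <= k)%nat -> jcont m k (fun _ w => w j r).
Proof.
  intros Hj Hr; apply jcont_near; intros x w eps He; exists eps; split; [exact He|].
  intros x' w' [_ Hw]; now apply Hw.
Qed.

Lemma jcont_add (m k : nat) (F G : JFun) :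
  jcont m k F -> jcont m k G -> jcont m k (fun x w => F x w + G x w).
Proof.
  rewrite !jcont_near; intros HF HG x w eps He.
  destruct (HF x w (eps / 2) ltac:(lra)) as [d1 [Hd1 H1]].
  destruct (HG x w (eps / 2) ltac:(lra)) as [d2 [Hd2 H2]].
  exists (Rmin d1 d2); split; [now apply Rmin_pos|]; intros x' w' Hn.
  specialize (H1 x' w' (near_le _ _ _ _ _ _ _ _ (Rmin_l _ _) Hn)).
  specialize (H2 x' w' (near_le _ _ _ _ _ _ _ _ (Rmin_r _ _) Hn)).
  apply Rabs_def2 in H1; apply Rabs_def2 in H2; apply Rabs_def1; lra.
Qed.

Lemma jcont_mul (m k : nat) (F G : JFun) :
  jcont m k F -> jcont m k G -> jcont m k (fun x w => F x w * G x w).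
Proof.
  rewrite !jcont_near; intros HF HG x w eps He.
  set (M := 1 + Rabs (F x w) + Rabs (G x w)).
  assert (HM : 1 <= M)
    by (unfold M; pose proof (Rabs_pos (F x w)); pose proof (Rabs_pos (G x w)); lra).
  (* With both increments below [e] and [e] at most 1, the three terms of the expanded difference
     add up to at most [e * M], hence at most [eps / 2]. *)
  set (e := Rmin 1 (eps / (2 * M))).
  assert (Hq : 0 < eps / (2 * M)) by (apply Rdiv_lt_0_compat; lra).
  assert (He' : 0 < e) by (apply Rmin_pos; lra).
  destruct (HF x w e He') as [d1 [Hd1 H1]].
  destruct (HG x w e He') as [d2 [Hd2 H2]].
  exists (Rmin d1 d2); split; [now apply Rmin_pos|]; intros x' w' Hn.
  specialize (H1 x' w' (near_le _ _ _ _ _ _ _ _ (Rmin_l _ _) Hn)).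
  specialize (H2 x' w' (near_le _ _ _ _ _ _ _ _ (Rmin_r _ _) Hn)).
  replace (F x' w' * G x' w' - F x w * G x w) with
    ((F x' w' - F x w) * (G x' w' - G x w)
     + ((F x' w' - F x w) * G x w + F x w * (G x' w' - G x w))) by ring.
  set (a := F x' w' - F x w) in *; set (b := G x' w' - G x w) in *.
  assert (e <= 1) by apply Rmin_l.
  assert (HeM : 2 * M * e <= eps).
  { apply Rle_trans with (2 * M * (eps / (2 * M))).
    - apply Rmult_le_compat_l; [lra | apply Rmin_r].
    - right; field; lra. }
  eapply Rle_lt_trans; [apply Rabs_triang|].
  eapply Rle_lt_trans; [apply Rplus_le_compat_l, Rabs_triang|].
  rewrite !Rabs_mult.
  pose proof (Rabs_pos a); pose proof (Rabs_pos b).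
  pose proof (Rabs_pos (F x w)); pose proof (Rabs_pos (G x w)).
  unfold M in *; nra.
Qed.

Lemma jcont_line (m k i p : nat) (F : JFun) (x : R) (w : Jet) (s : R) :
  jcont m k F -> continuous (fun s => F x (upd w i p s)) s.
Proof.
  intros HF; apply continuity_pt_filterlim, continuity_pt_locally; intros eps.
  rewrite jcont_near in HF.
  destruct (HF x (upd w i p s) eps (cond_pos eps)) as [d [Hd H]].
  exists (mkposreal d Hd); intros t Ht; apply H.
  apply near_upd; [now apply near_refl | exact Ht].
Qed.

Lemma jcont_ex_RInt (m k i p : nat) (F : JFun) (x : R) (w : Jet) (a b : R) :
  jcont m k F -> ex_RInt (fun s => F x (upd w i p s)) a b.
Proof. intros HF; apply (ex_RInt_continuous (V := R_CompleteNormedModule)); intros; now apply (jcont_line m k). Qed.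

(** Compactness of the segment makes the continuity radius uniform along it: each [s] lies near a
    centre [t] whose own radius is at least [d], and both points are compared with the value at that
    centre. *)
Lemma jcont_tube (m k i p : nat) (F : JFun) (x : R) (w : Jet) (a b eps : R) :
  jcont m k F -> 0 < eps -> exists d, 0 < d /\
    forall x' w' s, a <= s <= b -> near m k d x w x' w' ->
      Rabs (F x' (upd w' i p s) - F x (upd w i p s)) < eps.
Proof.
  rewrite jcont_near; intros HF He.
  assert (Hloc : forall t, { d : posreal | forall x' w', near m k d x (upd w i p t) x' w' ->
            Rabs (F x' w' - F x (upd w i p t)) < eps / 2 }).
  { intros t; apply constructive_indefinite_description.
    destruct (HF x (upd w i p t) (eps / 2) ltac:(lra)) as [d [Hd H]].
    now exists (mkposreal d Hd). }
  destruct (compactness_value_1d a b (fun t => proj1_sig (Hloc t))) as [d Hd].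
  exists d; split; [apply cond_pos|]; intros x' w' s Hs Hn.
  (* The compactness statement yields the centre [t] only under a double negation. *)
  apply NNPP; intros Hneg; apply (Hd s Hs); intros [t [_ [Hst Hdt]]]; apply Hneg.
  destruct (Hloc t) as [dt Ht]; simpl in *.
  assert (H1 : Rabs (F x' (upd w' i p s) - F x (upd w i p t)) < eps / 2).
  { apply Ht, near_upd; [|exact Hst]. now apply near_le with d. }
  assert (H2 : Rabs (F x (upd w i p s) - F x (upd w i p t)) < eps / 2).
  { apply Ht, near_upd; [|exact Hst]. apply near_refl, cond_pos. }
  apply Rabs_def2 in H1; apply Rabs_def2 in H2; apply Rabs_def1; lra.
Qed.

(** * Primitives in a single coordinate *)

Lemma RInt_abs_bound (f : R -> R) (a b M : R) :
  ex_RInt f a b -> (forall t, Rmin a b <= t <= Rmax a b -> Rabs (f t) <= M) ->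
  Rabs (RInt f a b) <= Rabs (b - a) * M.
Proof.
  intros Hf HM; destruct (Rle_dec a b) as [Hab|Hab].
  - rewrite (Rabs_pos_eq (b - a)) by lra.
    apply abs_RInt_le_const; [exact Hab|exact Hf|].
    intros t Ht; apply HM; rewrite Rmin_left, Rmax_right; lra.
  - rewrite <- opp_RInt_swap by now apply ex_RInt_swap.
    unfold opp; simpl; rewrite Rabs_Ropp, (Rabs_minus_sym b a), (Rabs_pos_eq (a - b)) by lra.
    apply abs_RInt_le_const; [lra|now apply ex_RInt_swap|].
    intros t Ht; apply HM; rewrite Rmin_right, Rmax_left; lra.
Qed.

Definition prim (i p : nat) (F : JFun) : JFun :=
  fun x w => RInt (fun s => F x (upd w i p s)) 0 (w i p).

(** Both the integrand and the upper limit move. The change splits into [I1 - I0], over the old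
    interval and small by [jcont_tube], and [I2], over the short interval from [b] to [b'], where
    the integrand is bounded by [M]. *)
Lemma jcont_prim (m k i p : nat) (F : JFun) :
  (i < m)%nat -> (p <= k)%nat -> jcont m k F -> jcont m k (prim i p F).
Proof.
  intros Hi Hp HF; pose proof HF as HFn; rewrite jcont_near in HFn.
  apply jcont_near; intros x w eps He.
  set (b := w i p).
  destruct (HFn x (upd w i p b) 1 ltac:(lra)) as [d1 [Hd1 H1]].
  set (M := Rabs (F x (upd w i p b)) + 1).
  assert (HM : 0 < M) by (unfold M; pose proof (Rabs_pos (F x (upd w i p b))); lra).
  (* The added 1 keeps the divisor positive when [b] is 0 and makes the estimate [B3] strict. *)
  set (L := Rabs (b - 0) + 1).
  assert (HL : 0 < L) by (unfold L; pose proof (Rabs_pos (b - 0)); lra).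
  assert (He2 : 0 < eps / (2 * L)) by (apply Rdiv_lt_0_compat; lra).
  destruct (jcont_tube m k i p F x w (Rmin 0 b) (Rmax 0 b) _ HF He2) as [d2 [Hd2 H2]].
  assert (He3 : 0 < eps / (2 * M)) by (apply Rdiv_lt_0_compat; lra).
  exists (Rmin d1 (Rmin d2 (eps / (2 * M)))); split; [repeat apply Rmin_pos; lra|].
  intros x' w' Hn.
  assert (Hn1 := near_le _ _ _ _ _ _ _ _ (Rmin_l _ _) Hn).
  assert (Hn23 := near_le _ _ _ _ _ _ _ _ (Rmin_r _ _) Hn).
  assert (Hn2 := near_le _ _ _ _ _ _ _ _ (Rmin_l _ _) Hn23).
  assert (Hn3 := near_le _ _ _ _ _ _ _ _ (Rmin_r _ _) Hn23).
  set (b' := w' i p).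
  assert (Hb1 : Rabs (b' - b) < d1) by now apply Hn1.
  assert (Hb3 : Rabs (b' - b) < eps / (2 * M)) by now apply Hn3.
  unfold prim; fold b b'.
  rewrite <- (RInt_Chasles (fun s => F x' (upd w' i p s)) 0 b b')
    by now apply (jcont_ex_RInt m k).
  change plus with Rplus.
  set (I1 := RInt (fun s => F x' (upd w' i p s)) 0 b).
  set (I2 := RInt (fun s => F x' (upd w' i p s)) b b').
  set (I0 := RInt (fun s => F x (upd w i p s)) 0 b).
  assert (B1 : Rabs (I1 - I0) <= Rabs (b - 0) * (eps / (2 * L))).
  { unfold I1, I0.
    change Rminus with (fun u v : R => @minus R_AbelianGroup u v); cbv beta.
    rewrite <- (RInt_minus (V := R_CompleteNormedModule)) by now apply (jcont_ex_RInt m k).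
    apply RInt_abs_bound.
    - apply (ex_RInt_minus (V := R_NormedModule)); now apply (jcont_ex_RInt m k).
    - intros t Ht; left; now apply H2. }
  assert (B2 : Rabs I2 <= Rabs (b' - b) * M).
  { apply RInt_abs_bound; [now apply (jcont_ex_RInt m k)|].
    intros t Ht.
    assert (Htb : Rabs (t - b) < d1).
    { apply Rabs_def2 in Hb1; apply Rabs_def1; revert Ht; unfold Rmin, Rmax;
        destruct (Rle_dec b b'); lra. }
    assert (H := H1 x' (upd w' i p t) (near_upd _ _ i p _ _ _ _ _ b t Hn1 Htb)).
    unfold M; pose proof (Rabs_triang_inv (F x' (upd w' i p t)) (F x (upd w i p b))); lra. }
  assert (B3 : Rabs (b - 0) * (eps / (2 * L)) < eps / 2).
  { apply Rlt_le_trans with (L * (eps / (2 * L))).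
    - apply Rmult_lt_compat_r; [exact He2 | unfold L; lra].
    - right; field; lra. }
  assert (B4 : Rabs (b' - b) * M < eps / 2).
  { apply Rlt_le_trans with (eps / (2 * M) * M).
    - now apply Rmult_lt_compat_r.
    - right; field; lra. }
  replace (I1 + I2 - I0) with ((I1 - I0) + I2) by ring.
  eapply Rle_lt_trans; [apply Rabs_triang|]; lra.
Qed.

Lemma has_pd_prim_same (m k i p : nat) (F : JFun) :
  jcont m k F -> has_pd (Some (i, p)) (prim i p F) F.
Proof.
  intros HF x w; apply is_derive_Reals; simpl.
  replace (F x w) with (F x (upd w i p (w i p))) by now rewrite upd_id.
  apply (is_derive_ext (fun t => RInt (fun s => F x (upd w i p s)) 0 t)).
  { intros t; unfold slice, prim; simpl; rewrite upd_same.
    apply RInt_ext; intros; now rewrite upd_upd. }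
  apply (is_derive_RInt (V := R_NormedModule) (fun s => F x (upd w i p s)) _ 0 (w i p)).
  - apply filter_forall; intros b; apply (RInt_correct (V := R_CompleteNormedModule)); now apply (jcont_ex_RInt m k).
  - now apply (jcont_line m k).
Qed.

(** Supplies the joint continuity of the derivative in the parameter and the integration variable
    that differentiation under the integral sign requires. *)
Lemma jcont_slice (m k : nat) (c : coord) (F : JFun) (x : R) (w : Jet) (t0 : R) (i p : nat)
    (s0 : R) :
  c <> Some (i, p) -> jcont m k F ->
  continuity_2d_pt (fun t s => slice c F x (upd w i p s) t) t0 s0.
Proof.
  intros Hc HF eps; rewrite jcont_near in HF.
  destruct (HF (setx c t0 x) (setw c t0 (upd w i p s0)) eps (cond_pos eps)) as [d [Hd H]].
  exists (mkposreal d Hd); intros t s Ht Hs; apply H.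
  assert (Hn : near m k d x (upd w i p s0) x (upd w i p s))
    by (apply near_upd; [now apply near_refl | exact Hs]).
  destruct c as [[j r]|]; simpl.
  - now apply near_upd.
  - split; [exact Ht | apply Hn].
Qed.

(** Differentiation under the integral sign. The coordinate [c] differs from the integration
    variable, so the upper limit [w i p] stays fixed and no boundary term appears. *)
Lemma has_pd_prim_other (m k : nat) (c : coord) (i p : nat) (F G : JFun) :
  c <> Some (i, p) -> jcont m k F -> jcont m k G -> has_pd c F G ->
  has_pd c (prim i p F) (prim i p G).
Proof.
  intros Hc HF HG H x w; apply is_derive_Reals.
  assert (HD : forall s t, is_derive (fun u => slice c F x (upd w i p s) u) t
                           (slice c G x (upd w i p s) t))
    by (intros s t; apply is_derive_Reals; now apply has_pd_slice).
  apply (is_derive_ext (fun t => RInt (fun s => slice c F x (upd w i p s) t) 0 (w i p))).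
  { intros t; unfold slice, prim.
    replace (setw c t w i p) with (w i p).
    - apply RInt_ext; intros s _.
      exact (f_equal (F (setx c t x)) (setw_comm c (Some (i, p)) t s w Hc)).
    - destruct c as [[j r]|]; simpl; [|reflexivity].
      symmetry; apply upd_other; congruence. }
  replace (prim i p G x w) with
    (RInt (fun s => Derive (fun u => slice c F x (upd w i p s) u) (cur c x w)) 0 (w i p)).
  - apply is_derive_RInt_param.
    + apply filter_forall; intros t s _; eexists; apply HD.
    + intros s _.
      apply continuity_2d_pt_ext with (fun t s => slice c G x (upd w i p s) t).
      * intros t s'; symmetry; apply is_derive_unique, HD.
      * now apply (jcont_slice m k).
    + apply filter_forall; intros t; apply ex_RInt_ext with
        (fun s => F (setx c t x) (upd (setw c t w) i p s)).
      * intros s _; symmetry.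
        exact (f_equal (F (setx c t x)) (setw_comm c (Some (i, p)) t s w Hc)).
      * now apply (jcont_ex_RInt m k).
  - unfold prim; apply RInt_ext; intros s _.
    rewrite <- (slice_cur c G x (upd w i p s)).
    assert (E : cur c x (upd w i p s) = cur c x w).
    { destruct c as [[j r]|]; simpl; [|reflexivity]. apply upd_other; congruence. }
    rewrite E; apply is_derive_unique, HD.
Qed.

Lemma depends_on_prim (m k i p : nat) (F : JFun) :
  (i < m)%nat -> (p <= k)%nat -> depends_on m k F -> depends_on m k (prim i p F).
Proof.
  intros Hi Hp HF x w w' Hw; unfold prim; rewrite (Hw i p) by assumption.
  apply RInt_ext; intros s _; exact (depends_on_slice m k (Some (i, p)) F x w w' s HF Hw).
Qed.

(* The closure of the smooth functions under the operations needed below; it is closed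
   under all partial derivatives, so [smooth_coind] applies to it. *)
Inductive generated (m k : nat) : JFun -> Prop :=
| gen_smooth F : Smooth m k F -> generated m k F
| gen_const a : generated m k (fun _ _ => a)
| gen_coord j r : (j < m)%nat -> (r <= k)%nat -> generated m k (fun _ w => w j r)
| gen_add F G : generated m k F -> generated m k G -> generated m k (fun x w => F x w + G x w)
| gen_mul F G : generated m k F -> generated m k G -> generated m k (fun x w => F x w * G x w)
| gen_prim i p F : (i < m)%nat -> (p <= k)%nat -> generated m k F ->
    generated m k (prim i p F).

Lemma generated_depends_on (m k : nat) (F : JFun) : generated m k F -> depends_on m k F.
Proof.
  induction 1 as [F HF|a|j r Hj Hr|F G _ IHF _ IHG|F G _ IHF _ IHG|i p F Hi Hp _ IH].
  - apply HF.
  - now intros x w w' _.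
  - intros x w w' Hw; now apply Hw.
  - intros x w w' Hw; now rewrite (IHF x w w' Hw), (IHG x w w' Hw).
  - intros x w w' Hw; now rewrite (IHF x w w' Hw), (IHG x w w' Hw).
  - now apply depends_on_prim.
Qed.

Lemma generated_jcont (m k : nat) (F : JFun) : generated m k F -> jcont m k F.
Proof.
  induction 1.
  - now apply smooth_jcont.
  - apply jcont_const.
  - now apply jcont_coord.
  - now apply jcont_add.
  - now apply jcont_mul.
  - now apply jcont_prim.
Qed.

Lemma generated_pd (m k : nat) (c : coord) (F : JFun) :
  generated m k F -> exists G, has_pd c F G /\ generated m k G.
Proof.
  induction 1 as [F HF|a|j r Hj Hr|F G HF [F' [HF' GF']] HG [G' [HG' GG']]
                 |F G HF [F' [HF' GF']] HG [G' [HG' GG']]|i p F Hi Hp HF [F' [HF' GF']]].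
  - exists (pd c F); split; [now apply (smooth_has_pd m k)|].
    now apply gen_smooth, smooth_pd.
  - eexists; split; [apply has_pd_const|]. apply gen_const.
  - eexists; split; [apply has_pd_coord|]. apply gen_const.
  - eexists; split; [now apply has_pd_add|]. now apply gen_add.
  - eexists; split; [now apply has_pd_mul|]. now apply gen_add; apply gen_mul.
  - destruct (classic (c = Some (i, p))) as [->|Hc].
    + exists F; split; [|exact HF].
      apply (has_pd_prim_same m k); now apply generated_jcont.
    + exists (prim i p F'); split; [|now apply gen_prim].
      apply (has_pd_prim_other m k); trivial; now apply generated_jcont.
Qed.

Lemma generated_Smooth (m k : nat) (F : JFun) : generated m k F -> Smooth m k F.
Proof.
  apply (smooth_coind m k (generated m k)); clear F; intros F HF; split; [|split].
  - now apply generated_depends_on.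
  - now apply generated_jcont.
  - intros c; now apply generated_pd.
Qed.

Lemma smooth_add (m k : nat) (F G : JFun) :
  Smooth m k F -> Smooth m k G -> Smooth m k (fun x w => F x w + G x w).
Proof. intros; apply generated_Smooth, gen_add; now apply gen_smooth. Qed.

Lemma smooth_mul (m k : nat) (F G : JFun) :
  Smooth m k F -> Smooth m k G -> Smooth m k (fun x w => F x w * G x w).
Proof. intros; apply generated_Smooth, gen_mul; now apply gen_smooth. Qed.

Lemma smooth_const (m k : nat) (a : R) : Smooth m k (fun _ _ => a).
Proof. apply generated_Smooth, gen_const. Qed.

Lemma smooth_coord (m k j r : nat) :
  (j < m)%nat -> (r <= k)%nat -> Smooth m k (fun _ w => w j r).
Proof. intros; now apply generated_Smooth, gen_coord. Qed.

Lemma smooth_prim (m k i p : nat) (F : JFun) :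
  (i < m)%nat -> (p <= k)%nat -> Smooth m k F -> Smooth m k (prim i p F).
Proof. intros; apply generated_Smooth, gen_prim; trivial; now apply gen_smooth. Qed.

(** Schwarz's theorem for the restriction of [F] to the plane of the two coordinates. The case
    [c = d] is split off because that plane, and the commuting of the two substitutions, require
    distinct coordinates. *)
Lemma pd_comm (m k : nat) (c d : coord) (F : JFun) :
  Smooth m k F -> pd c (pd d F) = pd d (pd c F).
Proof.
  intros HF; destruct (classic (c = d)) as [->|Hcd]; [reflexivity|].
  apply jfun_ext; intros x w.
  set (f u v := slice d F (setx c u x) (setw c u w) v).
  assert (Ec : forall G, Smooth m k G -> forall u v,
    is_derive (fun z => slice d G (setx c z x) (setw c z w) v) u
      (slice d (pd c G) (setx c u x) (setw c u w) v)).
  { intros G HG u v.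
    pose proof (has_pd_slice_other c d G (pd c G) (setx c u x) (setw c u w) v Hcd
      (smooth_has_pd m k c G HG)) as H.
    rewrite cur_set in H; apply is_derive_Reals in H.
    eapply is_derive_ext; [|exact H].
    intros z; cbv beta; now rewrite setx_setx, setw_setw. }
  assert (Ed : forall G, Smooth m k G -> forall u v,
    is_derive (fun z => slice d G (setx c u x) (setw c u w) z) v
      (slice d (pd d G) (setx c u x) (setw c u w) v)).
  { intros G HG u v; apply is_derive_Reals.
    apply has_pd_slice, (smooth_has_pd m k d G HG). }
  assert (Hc := smooth_pd m k c F HF); assert (Hd := smooth_pd m k d F HF).
  assert (E1 : forall u v, Derive (fun z => f z v) u =
            slice d (pd c F) (setx c u x) (setw c u w) v)
    by (intros; now apply is_derive_unique, Ec).
  assert (E2 : forall u v, Derive (fun z => f u z) v =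
            slice d (pd d F) (setx c u x) (setw c u w) v)
    by (intros; now apply is_derive_unique, Ed).
  assert (D12 : forall u v, is_derive (fun z => Derive (fun t => f z t) v) u
            (slice d (pd c (pd d F)) (setx c u x) (setw c u w) v)).
  { intros u v; eapply is_derive_ext; [intros z; symmetry; apply E2|]. now apply Ec. }
  assert (D21 : forall u v, is_derive (fun z => Derive (fun t => f t z) u) v
            (slice d (pd d (pd c F)) (setx c u x) (setw c u w) v)).
  { intros u v; eapply is_derive_ext; [intros z; symmetry; apply E1|]. now apply Ed. }
  assert (C : forall G, Smooth m k G -> forall u v, continuity_2d_pt
            (fun u v => slice d G (setx c u x) (setw c u w) v) u v).
  { intros G HG u v eps.
    pose proof (smooth_jcont m k G HG) as HGc; rewrite jcont_near in HGc.
    destruct (HGc (setx d v (setx c u x)) (setw d v (setw c u w)) eps (cond_pos eps))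
      as [dl [Hdl H]].
    exists (mkposreal dl Hdl); intros u' v' Hu Hv; apply H; simpl in Hu, Hv.
    assert (Hn : near m k dl (setx c u x) (setw c u w) (setx c u' x) (setw c u' w)).
    { pose proof (near_refl m k dl x w Hdl) as Hr.
      destruct c as [[j r]|]; simpl; [now apply near_upd | split; [exact Hu | apply Hr]]. }
    destruct d as [[j r]|]; simpl; [now apply near_upd | split; [exact Hv | apply Hn]]. }
  pose proof (Schwarz f (cur c x w) (cur d x w)) as S.
  assert (Sset : forall G, slice d G (setx c (cur c x w) x) (setw c (cur c x w) w) (cur d x w)
                   = G x w).
  { intros G; rewrite setx_cur, setw_cur; apply slice_cur. }
  rewrite (is_derive_unique _ _ _ (D12 _ _)), (is_derive_unique _ _ _ (D21 _ _)), !Sset in S.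
  apply S.
  - exists (mkposreal 1 Rlt_0_1); intros u v _ _; repeat split; eexists.
    + now apply Ec.
    + now apply Ed.
    + apply D12.
    + apply D21.
  - eapply continuity_2d_pt_ext;
      [intros u v; symmetry; apply is_derive_unique, D12 | now apply C, smooth_pd].
  - eapply continuity_2d_pt_ext;
      [intros u v; symmetry; apply is_derive_unique, D21 | now apply C, smooth_pd].
Qed.

(** * Total derivative and Euler operator *)

Lemma rsum_ext (n : nat) (f g : nat -> R) :
  (forall i, (i < n)%nat -> f i = g i) -> rsum n f = rsum n g.
Proof.
  intros H; induction n as [|n IH]; simpl; [reflexivity|].
  rewrite IH, H; auto with arith.
Qed.

Lemma rsum_add (n : nat) (f g : nat -> R) :
  rsum n (fun i => f i + g i) = rsum n f + rsum n g.
Proof. induction n as [|n IH]; simpl; [|rewrite IH]; ring. Qed.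

Lemma rsum_scal (n : nat) (a : R) (f : nat -> R) : rsum n (fun i => a * f i) = a * rsum n f.
Proof. induction n as [|n IH]; simpl; [|rewrite IH]; ring. Qed.

Lemma rsum_zero (n : nat) (f : nat -> R) :
  (forall i, (i < n)%nat -> f i = 0) -> rsum n f = 0.
Proof.
  intros H; induction n as [|n IH]; simpl; [reflexivity|].
  rewrite IH, H; auto with arith; ring.
Qed.

Lemma rsum_tail (n p : nat) (f : nat -> R) :
  (p <= n)%nat -> (forall i, (p <= i)%nat -> f i = 0) -> rsum n f = rsum p f.
Proof.
  intros Hp H; induction Hp as [|n Hp IH]; simpl; [reflexivity|].
  rewrite IH, H by exact Hp; ring.
Qed.

Lemma rsum_single (n p : nat) (f : nat -> R) :
  (p < n)%nat -> (forall i, i <> p -> f i = 0) -> rsum n f = f p.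
Proof.
  intros Hp H; rewrite (rsum_tail n (S p)) by (trivial; intros; apply H; lia); simpl.
  rewrite rsum_zero; [ring|]; intros; apply H; lia.
Qed.

Lemma has_pd_rsum (c : coord) (n : nat) (F G : nat -> JFun) :
  (forall i, (i < n)%nat -> has_pd c (F i) (G i)) ->
  has_pd c (fun x w => rsum n (fun i => F i x w)) (fun x w => rsum n (fun i => G i x w)).
Proof.
  intros H; induction n as [|n IH]; simpl; [apply has_pd_const|].
  apply (has_pd_add c (fun x w => rsum n (fun i => F i x w)) (F n)); auto with arith.
Qed.

Lemma smooth_rsum (m k n : nat) (F : nat -> JFun) :
  (forall i, (i < n)%nat -> Smooth m k (F i)) ->
  Smooth m k (fun x w => rsum n (fun i => F i x w)).
Proof.
  intros H; induction n as [|n IH]; simpl; [apply smooth_const|].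
  apply (smooth_add m k (fun x w => rsum n (fun i => F i x w)) (F n)); auto with arith.
Qed.

Lemma smooth_scal (m k : nat) (a : R) (F : JFun) :
  Smooth m k F -> Smooth m k (fun x w => a * F x w).
Proof. intros H; apply (smooth_mul m k (fun _ _ => a) F); [apply smooth_const | exact H]. Qed.

Lemma smooth_lin (m k : nat) (a : R) (F G : JFun) :
  Smooth m k F -> Smooth m k G -> Smooth m k (fun x w => F x w + a * G x w).
Proof. intros HF HG; apply smooth_add; [exact HF | now apply smooth_scal]. Qed.

Lemma has_pd_scal (c : coord) (a : R) (F G : JFun) :
  has_pd c F G -> has_pd c (fun x w => a * F x w) (fun x w => a * G x w).
Proof.
  intros H x w; pose proof (has_pd_mul c _ F _ G (has_pd_const c a) H x w) as E.
  cbv beta in E; rewrite Rmult_0_l, Rplus_0_l in E; exact E.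
Qed.

Lemma pd_lin (m k : nat) (c : coord) (a : R) (F G : JFun) :
  Smooth m k F -> Smooth m k G ->
  pd c (fun x w => F x w + a * G x w) = fun x w => pd c F x w + a * pd c G x w.
Proof.
  intros HF HG; apply has_pd_eq, has_pd_add; [|apply has_pd_scal];
    now apply (smooth_has_pd m k).
Qed.

Lemma pd_zero (c : coord) : pd c (fun _ _ => 0) = fun _ _ => 0.
Proof. apply has_pd_eq, has_pd_const. Qed.

Lemma pd_above (m k j r : nat) (F : JFun) :
  depends_on m k F -> (k < r)%nat -> pd (Some (j, r)) F = fun _ _ => 0.
Proof. intros HF Hr; apply has_pd_eq, (has_pd_out m k); auto. Qed.

Lemma totE (N m : nat) (F : JFun) : tot N m F = fun x w =>
  pd None F x w + rsum m (fun j => rsum N (fun r => w j (S r) * pd (Some (j, r)) F x w)).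
Proof. reflexivity. Qed.

Lemma smooth_tot (N m p : nat) (F : JFun) : Smooth m p F -> Smooth m (S p) (tot N m F).
Proof.
  intros HF; rewrite totE; apply smooth_add.
  - apply smooth_le with p; [lia|]; now apply smooth_pd.
  - apply (smooth_rsum m (S p) m (fun j x w =>
      rsum N (fun r => w j (S r) * pd (Some (j, r)) F x w))); intros j Hj.
    apply (smooth_rsum m (S p) N (fun r x w => w j (S r) * pd (Some (j, r)) F x w)).
    intros r _; destruct (le_lt_dec r p) as [Hr|Hr].
    + apply (smooth_mul m (S p) (fun _ w => w j (S r))); [apply smooth_coord; lia|].
      apply smooth_le with p; [lia|]; now apply smooth_pd.
    + rewrite (pd_above m p j r F (proj1 HF) Hr).
      replace (fun (x : R) (w : Jet) => w j (S r) * 0) with (fun (x : R) (w : Jet) => 0);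
        [apply smooth_const|].
      apply jfun_ext; intros; ring.
Qed.

Lemma tot_zero (N m : nat) : tot N m (fun _ _ => 0) = fun _ _ => 0.
Proof.
  rewrite totE; apply jfun_ext; intros x w; rewrite pd_zero, rsum_zero; [ring|].
  intros j _; apply rsum_zero; intros r _; rewrite pd_zero; ring.
Qed.

(** The truncation inside [euler] varies with the declared order, so Euler expressions at different
    orders become comparable only through this independence. *)
Lemma tot_truncation (N N' m p : nat) (F : JFun) :
  Smooth m p F -> (p < N)%nat -> (p < N')%nat -> tot N m F = tot N' m F.
Proof.
  intros HF HN HN'; rewrite !totE; apply jfun_ext; intros x w; f_equal.
  apply rsum_ext; intros j _.
  assert (Z : forall r, (S p <= r)%nat -> w j (S r) * pd (Some (j, r)) F x w = 0).
  { intros r Hr; rewrite (pd_above m p j r F (proj1 HF)) by lia; ring. }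
  rewrite (rsum_tail N (S p)), (rsum_tail N' (S p)); trivial.
Qed.

Lemma tot_lin (N m k : nat) (a : R) (F G : JFun) :
  Smooth m k F -> Smooth m k G ->
  tot N m (fun x w => F x w + a * G x w) = fun x w => tot N m F x w + a * tot N m G x w.
Proof.
  intros HF HG; rewrite !totE; apply jfun_ext; intros x w.
  rewrite (pd_lin m k) by assumption.
  rewrite Rmult_plus_distr_l, <- rsum_scal.
  match goal with |- _ = ?u + ?v + (?s + ?t) => replace (u + v + (s + t)) with (u + s + (v + t)) by ring end.
  rewrite <- rsum_add; f_equal; apply rsum_ext; intros j _.
  rewrite <- rsum_scal, <- rsum_add; apply rsum_ext; intros r _.
  rewrite (pd_lin m k) by assumption; ring.
Qed.

(** The extra term comes from differentiating the coefficient w^j_{s+1} of D with s + 1 = r. The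
    bound [r <= N] ensures that this summand survives the truncation; for r = 0 no coefficient is
    hit. *)
Lemma pd_tot (N m p j r : nat) (F : JFun) :
  Smooth m p F -> (j < m)%nat -> (r <= N)%nat ->
  pd (Some (j, r)) (tot N m F) = fun x w => tot N m (pd (Some (j, r)) F) x w
    + match r with O => 0 | S r' => pd (Some (j, r')) F x w end.
Proof.
  intros HF Hj Hr; set (c := Some (j, r)).
  assert (HD : forall d, has_pd c (pd d F) (pd c (pd d F)))
    by (intros; now apply (smooth_has_pd m p), smooth_pd).
  rewrite totE, (has_pd_eq c _ (fun x w => pd c (pd None F) x w +
    rsum m (fun i => rsum N (fun s => delta c i (S s) * pd (Some (i, s)) F x w
                                    + w i (S s) * pd c (pd (Some (i, s)) F) x w)))).
  2:{ apply has_pd_add; [apply HD|].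
      apply (has_pd_rsum c m (fun i x w => rsum N (fun s => w i (S s) * pd (Some (i, s)) F x w))
        (fun i x w => rsum N (fun s => delta c i (S s) * pd (Some (i, s)) F x w
                                    + w i (S s) * pd c (pd (Some (i, s)) F) x w))).
      intros i _.
      apply (has_pd_rsum c N (fun s x w => w i (S s) * pd (Some (i, s)) F x w)
        (fun s x w => delta c i (S s) * pd (Some (i, s)) F x w
                                    + w i (S s) * pd c (pd (Some (i, s)) F) x w)).
      intros s _; apply (has_pd_mul c (fun _ w => w i (S s)) (pd (Some (i, s)) F)
        (fun _ _ => delta c i (S s)) (pd c (pd (Some (i, s)) F))); [apply has_pd_coord|apply HD]. }
  apply jfun_ext; intros x w; rewrite totE.
  rewrite (pd_comm m p c None F HF).
  rewrite (rsum_ext m _ (fun i => rsum N (fun s => delta c i (S s) * pd (Some (i, s)) F x w)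
     + rsum N (fun s => w i (S s) * pd (Some (i, s)) (pd c F) x w))).
  2:{ intros i _; rewrite rsum_add; f_equal; apply rsum_ext; intros s _.
      now rewrite (pd_comm m p c). }
  rewrite rsum_add.
  match goal with |- ?a + (?b + ?e) = _ => replace (a + (b + e)) with (a + e + b) by ring end.
  f_equal; unfold c, delta; destruct r as [|r].
  - apply rsum_zero; intros i _; apply rsum_zero; intros s _.
    rewrite Bool.andb_false_r; ring.
  - rewrite (rsum_single m j); [|exact Hj|].
    + rewrite (rsum_single N r); [|lia|].
      * rewrite !Nat.eqb_refl; simpl; ring.
      * intros s Hs. rewrite (proj2 (Nat.eqb_neq (S s) (S r))), Bool.andb_false_r by lia; ring.
    + intros i Hi; apply rsum_zero; intros s _.
      rewrite (proj2 (Nat.eqb_neq i j) Hi); simpl; ring.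
Qed.

Lemma smooth_iter_tot (N m p n : nat) (F : JFun) :
  Smooth m p F -> Smooth m (p + n) (Nat.iter n (tot N m) F).
Proof.
  intros HF; induction n as [|n IH]; simpl.
  - now rewrite Nat.add_0_r.
  - rewrite Nat.add_succ_r; now apply smooth_tot.
Qed.

Lemma iter_tot_zero (N m n : nat) : Nat.iter n (tot N m) (fun _ _ => 0) = fun _ _ => 0.
Proof. induction n as [|n IH]; simpl; [reflexivity|]. rewrite IH; apply tot_zero. Qed.

Lemma iter_tot_truncation (N N' m p n : nat) (F : JFun) :
  Smooth m p F -> (p + n <= N)%nat -> (p + n <= N')%nat ->
  Nat.iter n (tot N m) F = Nat.iter n (tot N' m) F.
Proof.
  intros HF; induction n as [|n IH]; simpl; intros HN HN'; [reflexivity|].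
  rewrite IH by lia; apply tot_truncation with (p + n)%nat; try lia.
  now apply smooth_iter_tot.
Qed.

Lemma iter_tot_lin (N m k n : nat) (a : R) (F G : JFun) :
  Smooth m k F -> Smooth m k G ->
  Nat.iter n (tot N m) (fun x w => F x w + a * G x w) =
  fun x w => Nat.iter n (tot N m) F x w + a * Nat.iter n (tot N m) G x w.
Proof.
  intros HF HG; induction n as [|n IH]; simpl; [reflexivity|].
  rewrite IH; apply tot_lin with (k + n)%nat; now apply smooth_iter_tot.
Qed.

(** Each D raises the order by one and carries the top coefficient along: in the commutator formula
    the first term vanishes, since its argument does not involve the new top variable. *)
Lemma pd_iter_tot (N m p n j : nat) (F : JFun) :
  Smooth m p F -> (j < m)%nat -> (p + n <= N)%nat ->
  pd (Some (j, (p + n)%nat)) (Nat.iter n (tot N m) F) = pd (Some (j, p)) F.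
Proof.
  intros HF Hj; induction n as [|n IH]; simpl; intros HN.
  - now rewrite Nat.add_0_r.
  - assert (HS := smooth_iter_tot N m p n F HF).
    rewrite (pd_tot N m (p + n)) by (trivial; lia).
    rewrite (pd_above m (p + n) j (p + S n)) by (apply HS || lia).
    rewrite tot_zero, Nat.add_succ_r, IH by lia.
    apply jfun_ext; intros; ring.
Qed.

Lemma eulerE (m k : nat) (f : JFun) (j : nat) : euler m k f j = fun x w =>
  rsum (S k) (fun r =>
    (-1) ^ r * Nat.iter r (tot (2 * k + 1) m) (pd (Some (j, r)) f) x w).
Proof. reflexivity. Qed.

(** The additional summand differentiates [f] by a variable of order k + 1, which is absent; the
    others change only in their truncation. *)
Lemma euler_raise (m k j : nat) (f : JFun) :
  Smooth m k f -> euler m (S k) f j = euler m k f j.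
Proof.
  intros Hf; rewrite !eulerE; apply jfun_ext; intros x w.
  rewrite (rsum_tail (S (S k)) (S k)); [|lia|].
  - apply rsum_ext; intros r Hr; f_equal.
    now rewrite (iter_tot_truncation (2 * k + 1) (2 * S k + 1) m k)
      by (apply smooth_pd || lia; trivial).
  - intros r Hr; rewrite (pd_above m k j r f (proj1 Hf)), iter_tot_zero by lia; ring.
Qed.

Lemma euler_lin (m k j : nat) (a : R) (f g : JFun) :
  Smooth m k f -> Smooth m k g ->
  euler m k (fun x w => f x w + a * g x w) j =
  fun x w => euler m k f j x w + a * euler m k g j x w.
Proof.
  intros Hf Hg; rewrite !eulerE; apply jfun_ext; intros x w.
  rewrite <- rsum_scal, <- rsum_add; apply rsum_ext; intros r _.
  rewrite (pd_lin m k), (iter_tot_lin _ m k) by (trivial; now apply smooth_pd); ring.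
Qed.

(* The commutator [d_{j,r}, D] = d_{j,r-1} makes the alternating sum telescope. *)
Lemma euler_tot (m k j : nat) (h : JFun) :
  Smooth m k h -> (j < m)%nat ->
  euler m (S k) (tot (2 * S k + 1) m h) j = fun _ _ => 0.
Proof.
  intros Hh Hj; rewrite eulerE; set (N := (2 * S k + 1)%nat).
  apply jfun_ext; intros x w.
  (* The partial sums telescope to a single remainder. At n = k + 1 it contains the derivative of
     [h] by a variable above its order, hence vanishes. *)
  assert (T : forall n, (n <= N)%nat ->
    rsum (S n) (fun r => (-1) ^ r * Nat.iter r (tot N m) (pd (Some (j, r)) (tot N m h)) x w)
    = (-1) ^ n * Nat.iter (S n) (tot N m) (pd (Some (j, n)) h) x w).
  { induction n as [|n IH]; intros Hn.
    - change (0 + 1 * pd (Some (j, 0%nat)) (tot N m h) x w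
              = 1 * tot N m (pd (Some (j, 0%nat)) h) x w).
      rewrite (pd_tot N m k) by (trivial; lia); ring.
    - change (rsum (S (S n)) ?f) with (rsum (S n) f + f (S n)); cbv beta.
      rewrite IH by lia.
      rewrite (pd_tot N m k) by (trivial; lia).
      replace (fun x w => tot N m (pd (Some (j, S n)) h) x w + pd (Some (j, n)) h x w) with
        (fun x w => tot N m (pd (Some (j, S n)) h) x w + 1 * pd (Some (j, n)) h x w)
        by (apply jfun_ext; intros; ring).
      rewrite (iter_tot_lin N m (S k)).
      + rewrite <- Nat.iter_succ_r; simpl pow; ring.
      + now apply smooth_tot, smooth_pd.
      + apply smooth_le with k; [lia|]; now apply smooth_pd. }
  rewrite T by (unfold N; lia).
  rewrite (pd_above m k j (S k) h (proj1 Hh)), iter_tot_zero by lia; ring.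
Qed.

(** * The two highest coefficients of the Euler expressions *)

Lemma pd_euler (m k j : nat) (c : coord) (f : JFun) :
  Smooth m k f -> pd c (euler m k f j) = fun x w => rsum (S k) (fun r =>
    (-1) ^ r * pd c (Nat.iter r (tot (2 * k + 1) m) (pd (Some (j, r)) f)) x w).
Proof.
  intros Hf; rewrite eulerE; apply has_pd_eq.
  apply (has_pd_rsum c (S k)
    (fun r x w => (-1) ^ r * Nat.iter r (tot (2 * k + 1) m) (pd (Some (j, r)) f) x w)
    (fun r x w => (-1) ^ r * pd c (Nat.iter r (tot (2 * k + 1) m) (pd (Some (j, r)) f)) x w)).
  intros r _; apply has_pd_scal, (smooth_has_pd m (k + r)); now apply smooth_iter_tot, smooth_pd.
Qed.

(** The summand with index r has order at most k + r, so only r = k reaches w_{2k}, and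
    [pd_iter_tot] strips its k total derivatives. *)
Lemma pd_euler_top (m k i j : nat) (f : JFun) (x : R) (w : Jet) :
  Smooth m k f -> (i < m)%nat ->
  pd (Some (i, (k + k)%nat)) (euler m k f j) x w
  = (-1) ^ k * pd (Some (i, k)) (pd (Some (j, k)) f) x w.
Proof.
  intros Hf Hi; rewrite (pd_euler m k) by assumption; cbv beta.
  change (rsum (S k) ?f) with (rsum k f + f k); cbv beta.
  rewrite rsum_zero.
  - rewrite (pd_iter_tot _ m k k) by (lia || assumption || now apply smooth_pd); ring.
  - intros r Hr; rewrite (pd_above m (k + r)); [ring | |lia].
    now apply smooth_iter_tot, smooth_pd.
Qed.

(** Since the top coefficient is assumed to have order k, the summands r = k and r = k + 1 both have
    order at most 2k + 1, and w_{2k+1} is a top variable for each. Their opposite signs produce the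
    difference. *)
Lemma pd_euler_subtop (m k i j : nat) (f : JFun) (x : R) (w : Jet) :
  Smooth m (S k) f -> Smooth m k (pd (Some (j, S k)) f) -> (i < m)%nat ->
  pd (Some (i, (S k + k)%nat)) (euler m (S k) f j) x w
  = (-1) ^ k * (pd (Some (i, S k)) (pd (Some (j, k)) f) x w
                - pd (Some (i, k)) (pd (Some (j, S k)) f) x w).
Proof.
  intros Hf Hb Hi; rewrite (pd_euler m (S k)) by assumption; cbv beta.
  change (rsum (S (S k)) ?f) with (rsum k f + f k + f (S k)); cbv beta.
  rewrite rsum_zero.
  - rewrite (pd_iter_tot _ m (S k) k) by (lia || assumption || now apply smooth_pd).
    replace (S k + k)%nat with (k + S k)%nat by lia.
    rewrite (pd_iter_tot _ m k (S k)) by (trivial; lia).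
    simpl pow; ring.
  - intros r Hr; rewrite (pd_above m (S k + r)); [ring | |lia].
    now apply smooth_iter_tot, smooth_pd.
Qed.

(** * Lowering the order of a Lagrangian *)

Lemma pd_zero_slice (m k : nat) (c : coord) (F : JFun) (x : R) (w : Jet) (s t : R) :
  Smooth m k F -> pd c F = (fun _ _ => 0) -> slice c F x w s = slice c F x w t.
Proof.
  intros HF HZ.
  assert (HD : forall u, is_derive (slice c F x w) u 0).
  { intros u; apply is_derive_Reals.
    pose proof (has_pd_slice c F (pd c F) x w u (smooth_has_pd m k c F HF)) as H.
    now rewrite HZ in H. }
  destruct (Rtotal_order s t) as [Hst|[->|Hst]]; [|reflexivity|symmetry];
    apply (eq_is_derive (V := R_NormedModule)); trivial; intros; apply HD.
Qed.

Lemma smooth_lower (m k : nat) (F : JFun) :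
  Smooth m (S k) F -> (forall j, (j < m)%nat -> pd (Some (j, S k)) F = fun _ _ => 0) ->
  Smooth m k F.
Proof.
  intros HF HZ; apply smooth_order with (S k); [exact HF|]; intros x w w' Hw.
  (* A path from [w] towards [w'] that replaces the top variables one at a time; each replacement
     moves along a slice on which [F] is constant. *)
  set (v n := fun j r => if (Nat.eqb r (S k) && Nat.ltb j n)%bool then w' j r else w j r).
  assert (E : forall n, (n <= m)%nat -> F x (v n) = F x w).
  { induction n as [|n IH]; intros Hn.
    - f_equal; apply jet_ext; intros j r; unfold v.
      rewrite Bool.andb_comm; reflexivity.
    - rewrite <- IH by lia.
      replace (v (S n)) with (upd (v n) n (S k) (w' n (S k))).
      + rewrite <- (slice_cur (Some (n, S k)) F x (v n)).
        apply (pd_zero_slice m (S k) (Some (n, S k))); [exact HF|]; apply HZ; lia.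
      + apply jet_ext; intros j r; unfold v.
        destruct (upd_cases (v n) n (S k) (w' n (S k)) j r) as [[[= -> ->] Eu]|[Hne Eu]];
          unfold v in Eu; rewrite Eu.
        * rewrite Nat.eqb_refl, (proj2 (Nat.ltb_lt n (S n))) by lia; reflexivity.
        * destruct (Nat.eqb_spec r (S k)), (Nat.ltb_spec j n), (Nat.ltb_spec j (S n));
            simpl; try reflexivity; try lia.
          contradiction Hne; f_equal; lia. }
  rewrite <- (E m (Nat.le_refl m)); apply HF; intros j r Hj Hr; unfold v.
  destruct (Nat.eqb_spec r (S k)); simpl; [|apply Hw; lia].
  now rewrite (proj2 (Nat.ltb_lt j m)).
Qed.

Lemma sign_cancel (n : nat) (a : R) : (-1) ^ n * a = 0 -> a = 0.
Proof.
  intros H; apply Rmult_integral in H as [H|H]; [|exact H].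
  exfalso; revert H; apply pow_nonzero; lra.
Qed.

Lemma prim_zero (i p : nat) : prim i p (fun _ _ => 0) = fun _ _ => 0.
Proof.
  apply jfun_ext; intros x w; unfold prim; rewrite RInt_const.
  unfold scal; simpl; unfold mult; simpl; ring.
Qed.

(* The two highest-order coefficients of [E f] vanish, so the top coefficients
   b_j = d_{j,k+1} f have order k and form a closed 1-form in the variables w_k; hence
   subtracting D(int b_i dw^i_k) kills b_i without disturbing the b_j that are already 0. *)
Lemma kill_top_coefficient (m k i : nat) (f : JFun) :
  (1 <= k)%nat -> (i < m)%nat -> Smooth m (S k) f ->
  (forall j, (j < m)%nat -> depends_on m 2 (euler m (S k) f j)) ->
  (forall j, (j < i)%nat -> pd (Some (j, S k)) f = fun _ _ => 0) ->
  exists f', Smooth m (S k) f' /\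
    (forall j, (j < m)%nat -> euler m (S k) f' j = euler m (S k) f j) /\
    (forall j, (j < S i)%nat -> pd (Some (j, S k)) f' = fun _ _ => 0).
Proof.
  intros Hk Hi Hf HE HZ.
  assert (Hb : forall j, (j < m)%nat -> Smooth m k (pd (Some (j, S k)) f)).
  { intros j Hj; apply smooth_lower; [now apply smooth_pd|]; intros l Hl.
    apply jfun_ext; intros x w; apply sign_cancel with (S k).
    rewrite <- (pd_euler_top m (S k)) by assumption.
    rewrite (pd_above m 2) by (auto; lia); reflexivity. }
  (* The index here is 2k + 1, that of [Hb] is 2k + 2; both exceed 2 precisely because [1 <= k]. *)
  assert (Hclosed : forall j l, (j < m)%nat -> (l < m)%nat ->
    pd (Some (l, k)) (pd (Some (j, S k)) f) = pd (Some (j, k)) (pd (Some (l, S k)) f)).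
  { intros j l Hj Hl; apply jfun_ext; intros x w.
    rewrite (pd_comm m (S k) (Some (j, k))) by exact Hf.
    symmetry; apply Rminus_diag_uniq, sign_cancel with k.
    rewrite <- (pd_euler_subtop m k l j f x w Hf (Hb j Hj) Hl).
    rewrite (pd_above m 2) by (auto; lia); reflexivity. }
  set (b := pd (Some (i, S k)) f) in *.
  set (h := prim i k b).
  assert (Hh : Smooth m k h) by (apply smooth_prim; [exact Hi | lia | exact (Hb i Hi)]).
  set (N := (2 * S k + 1)%nat).
  assert (HD : Smooth m (S k) (tot N m h)) by now apply smooth_tot.
  exists (fun x w => f x w + (-1) * tot N m h x w); split; [|split].
  - now apply smooth_lin.
  - intros j Hj; rewrite euler_lin by assumption; unfold N; rewrite euler_tot by assumption.
    apply jfun_ext; intros; ring.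
  - intros j Hj.
    rewrite (pd_lin m (S k)) by assumption.
    rewrite (pd_tot N m k) by (trivial; unfold N; lia).
    rewrite (pd_above m k j (S k) h (proj1 Hh)), tot_zero by lia.
    (* By the commutator, the top coefficient of D h is the derivative of [h] by w^j_k. For j = i
       this is the integrand; for j < i, closedness turns the derivative of b_i by w^j_k into that
       of b_j by w^i_k, which is 0. *)
    assert (Eh : pd (Some (j, k)) h = pd (Some (j, S k)) f).
    { destruct (Nat.eq_dec j i) as [->|Hji].
      - apply has_pd_eq, (has_pd_prim_same m k); now apply smooth_jcont, Hb.
      - rewrite HZ by lia; rewrite <- (prim_zero i k); apply has_pd_eq.
        replace (fun (_ : R) (_ : Jet) => 0) with (pd (Some (j, k)) b).
        + apply (has_pd_prim_other m k); [congruence | | |].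
          * now apply smooth_jcont, Hb.
          * now apply smooth_jcont, smooth_pd, Hb.
          * now apply (smooth_has_pd m k), Hb.
        + unfold b; rewrite Hclosed by lia; rewrite HZ by lia; apply pd_zero. }
    rewrite Eh; apply jfun_ext; intros; ring.
Qed.

(** The dependent variables are treated in turn. Each correction alters the Lagrangian but not its
    Euler expressions, so the second-order hypothesis, and with it closedness, is available afresh
    for the next one. *)
Lemma lower_order (m k : nat) (f : JFun) :
  (1 <= k)%nat -> Smooth m (S k) f ->
  (forall j, (j < m)%nat -> depends_on m 2 (euler m (S k) f j)) ->
  exists g, Smooth m k g /\ forall j, (j < m)%nat -> euler m k g j = euler m (S k) f j.
Proof.
  intros Hk Hf HE.
  assert (I : forall i, (i <= m)%nat -> exists f', Smooth m (S k) f' /\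
    (forall j, (j < m)%nat -> euler m (S k) f' j = euler m (S k) f j) /\
    (forall j, (j < i)%nat -> pd (Some (j, S k)) f' = fun _ _ => 0)).
  { induction i as [|i IH]; intros Hi.
    - exists f; split; [exact Hf|split; [reflexivity|lia]].
    - destruct IH as [f1 [H1 [E1 Z1]]]; [lia|].
      destruct (kill_top_coefficient m k i f1) as [f2 [H2 [E2 Z2]]]; trivial.
      + intros j Hj; rewrite E1 by exact Hj; auto.
      + exists f2; split; [exact H2|split; [|exact Z2]].
        intros j Hj; rewrite E2, E1; trivial. }
  destruct (I m (Nat.le_refl m)) as [g [Hg [Eg Zg]]].
  assert (Hg' : Smooth m k g) by now apply smooth_lower.
  exists g; split; [exact Hg'|]; intros j Hj.
  rewrite <- euler_raise by exact Hg'; now apply Eg.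
Qed.

Lemma first_order_lagrangian (m k : nat) (f : JFun) :
  Smooth m (S k) f -> (forall j, (j < m)%nat -> depends_on m 2 (euler m (S k) f j)) ->
  exists g, Smooth m 1 g /\ forall j, (j < m)%nat -> euler m 1 g j = euler m (S k) f j.
Proof.
  revert f; induction k as [|k IH]; intros f Hf HE.
  - now exists f.
  - destruct (lower_order m (S k) f) as [f1 [H1 E1]]; trivial; [lia|].
    destruct (IH f1 H1) as [g [Hg Eg]].
    + intros j Hj; rewrite E1 by exact Hj; auto.
    + exists g; split; [exact Hg|]; intros j Hj; rewrite Eg, E1; trivial.
Qed.

(** * The first-order case and the conclusion *)

Lemma euler_first_order (m j : nat) (g : JFun) (x : R) (w : Jet) :
  Smooth m 1 g ->
  euler m 1 g j x w =
    pd (Some (j, 0%nat)) g x w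
    + (-1) * (pd None (pd (Some (j, 1%nat)) g) x w
       + rsum m (fun i => w i 1%nat * pd (Some (i, 0%nat)) (pd (Some (j, 1%nat)) g) x w))
    - rsum m (fun i => pd (Some (i, 1%nat)) (pd (Some (j, 1%nat)) g) x w * w i 2%nat).
Proof.
  intros Hg; assert (HP : Smooth m 1 (pd (Some (j, 1%nat)) g)) by now apply smooth_pd.
  set (P := pd (Some (j, 1%nat)) g) in *.
  change (euler m 1 g j x w) with
    (0 + 1 * pd (Some (j, 0%nat)) g x w + (-1) * 1 * tot 3 m P x w).
  (* [euler] truncates at 2 * 1 + 1 = 3, but [P] has order 1: two terms remain, and the one with r =
     1 carries w_2. *)
  rewrite (tot_truncation 3 2 m 1) by (trivial; lia); rewrite totE.
  rewrite (rsum_ext m _ (fun i => w i 1%nat * pd (Some (i, 0%nat)) P x w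
                                  + pd (Some (i, 1%nat)) P x w * w i 2%nat))
    by (intros; simpl; ring).
  rewrite rsum_add; ring.
Qed.

Theorem theorem4p2 (m : nat) (e : nat -> JFun) :
  (forall j, (j < m)%nat -> Smooth m 2 (e j)) ->
  (exists (k : nat) (f : JFun), Smooth m k f /\
     forall j, (j < m)%nat -> forall x w, e j x w = euler m k f j x w) ->
  (exists (F : nat -> JFun) (FF : nat -> nat -> JFun),
     (forall j, (j < m)%nat -> Smooth m 1 (F j)) /\
     (forall j j', (j < m)%nat -> (j' < m)%nat ->
        Smooth m 1 (FF j j') /\ forall x w, FF j j' x w = FF j' j x w) /\
     (forall j, (j < m)%nat -> forall x w,
        e j x w = F j x w - rsum m (fun j' => FF j j' x w * w j' 2%nat))) /\
  (exists g : JFun, Smooth m 1 g /\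
     forall j, (j < m)%nat -> forall x w, euler m 1 g j x w = e j x w).
Proof.
  intros He [k [f [Hf Ef]]].
  destruct (first_order_lagrangian m k f) as [g [Hg Eg]].
  (* Regarding [f] as of order k + 1 covers the case k = 0, since the descent ends at order 1. *)
  - now apply smooth_le with k; [lia|].
  - intros j Hj; rewrite euler_raise by exact Hf.
    (* The second-order hypothesis on the Euler expressions is inherited from [e j]. *)
    rewrite <- (jfun_ext (e j) (euler m k f j)) by auto.
    now apply He.
  - assert (E : forall j, (j < m)%nat -> forall x w, euler m 1 g j x w = e j x w)
      by (intros j Hj x w; rewrite Eg, euler_raise, Ef; trivial).
    split; [|now exists g].
    exists (fun j x w => pd (Some (j, 0%nat)) g x w
      + (-1) * (pd None (pd (Some (j, 1%nat)) g) x w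
       + rsum m (fun i => w i 1%nat * pd (Some (i, 0%nat)) (pd (Some (j, 1%nat)) g) x w))).
    exists (fun j i => pd (Some (i, 1%nat)) (pd (Some (j, 1%nat)) g)).
    split; [|split].
    + intros j Hj; apply smooth_lin; [now apply smooth_pd|].
      apply smooth_add; [now do 2 apply smooth_pd|].
      apply (smooth_rsum m 1 m (fun i x w =>
        w i 1%nat * pd (Some (i, 0%nat)) (pd (Some (j, 1%nat)) g) x w)); intros i Hi.
      apply (smooth_mul m 1 (fun _ w => w i 1%nat)); [now apply smooth_coord|].
      now do 2 apply smooth_pd.
    + intros j i Hj Hi; split; [now do 2 apply smooth_pd|].
      intros x w; now rewrite (pd_comm m 1).
    + intros j Hj x w; rewrite <- E by exact Hj; now apply euler_first_order.
Qed.
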